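(* Let $\alpha,\beta,\gamma,\delta>-1$, $N\ge1$, and let $\mathcal S=\{s_1,\ldots,s_N\}$ be an $\omega_{\gamma,\delta}$-admissible family of nondegenerate intervals in $[-1,1]$. Let $V_{\alpha,\beta}=\operatorname{span}\{P_1^{(\alpha,\beta)},\ldots,P_N^{(\alpha,\beta)}\}$. Then there exists a basis $\Phi=\{\phi_1,\ldots,\phi_N\}$ of $V_{\alpha,\beta}$ such that the matrix of the linear map \[ \mathcal J_{\mathcal S}^{(\alpha,\beta;\gamma,\delta)}:\Pi_N\to\mathbb R^{N+1},\qquad p\mapsto\left[\mathcal M_{\alpha,\beta}(p),\mathcal D_1^{\omega_{\gamma,\delta}}(p),\ldots,\mathcal D_N^{\omega_{\gamma,\delta}}(p)\right]^\top, \] with respect to the basis $\{1,\phi_1,\ldots,\phi_N\}$ of $\Pi_N$ and the canonical basis of $\mathbb R^{N+1}$, has the block form \[ \begin{bmatrix} h_0^{(\alpha,\beta)} & \boldsymbol 0^\top\\ \boldsymbol 0 & D_{\Phi,N}^{(\alpha,\beta;\gamma,\delta)}\end{bmatrix}, \qquad\text{where}\qquad \left(D_{\Phi,N}^{(\alpha,\beta;\gamma,\delta)}\right)^\top D_{\Phi,N}^{(\alpha,\beta;\gamma,\delta)}=I_N . \]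
   Context: $\Pi_n$ is the space of real univariate polynomials of degree at most $n$. $\omega_{a,b}(x)=(1-x)^a(1+x)^b$ on $(-1,1)$. $P_k^{(\alpha,\beta)}$ is the Jacobi polynomial of degree $k$ in the standard normalization, orthogonal on $[-1,1]$ with respect to $\omega_{\alpha,\beta}$. $\mathcal M_{\alpha,\beta}(f)=\int_{-1}^1f(x)\omega_{\alpha,\beta}(x)\,dx$, $h_0^{(\alpha,\beta)}=\mathcal M_{\alpha,\beta}(1)$, and $\mathcal D_i^{\omega}(f)=\int_{s_i}f'(x)\omega(x)\,dx$. The lower-right block is $D_{\Phi,N}^{(\alpha,\beta;\gamma,\delta)}=\left[\int_{s_i}\phi_k'(x)\omega_{\gamma,\delta}(x)\,dx\right]_{i,k=1}^N$. A family of intervals $s_i=[a_i,b_i]\subset[-1,1]$, $a_i<b_i$, $i=1,\ldots,N$, is $\omega$-admissible if the linear map $\Pi_{N-1}\to\mathbb R^N$, $q\mapsto[\int_{s_i}q\,\omega\,dx]_{i=1}^N$, is an isomorphism. $I_N$ is the $N\times N$ identity matrix. *)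

(* Defs.v *)
From HB Require Import structures.
From mathcomp Require Import all_boot all_order all_algebra.
From mathcomp Require Import all_classical all_reals all_analysis.

Set Implicit Arguments.
Unset Strict Implicit.
Unset Printing Implicit Defensive.

Import Order.TTheory GRing.Theory Num.Theory.
Import numFieldNormedType.Exports.

Local Open Scope classical_set_scope.
Local Open Scope ring_scope.

(* {poly_n R} bounds the size, i.e. one plus the degree. *)
Notation Pi R n := {poly_n.+1 R}.

(* Only values on ]-1, 1[ matter: the integrals below are Lebesgue integrals,
   so the conventional values of powR at the endpoints are irrelevant. *)
Definition jweight (R : realType) (a b : R) (x : R) : R :=
  (1 - x) `^ a * (1 + x) `^ b.

Definition gbinom (R : realType) (x : R) (m : nat) : R :=
  (\prod_(i < m) (x - i%:R)) / m`!%:R.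

(* Expansion equivalent to Rodrigues' formula
     (-1)^k / (2^k k!) (1-x)^-a (1+x)^-b d^k/dx^k ((1-x)^(a+k) (1+x)^(b+k)),
   with value gbinom (k + a) k at 1; unlike the hypergeometric and recurrence
   forms it has no exceptional parameters. *)
Definition jacobi (R : realType) (a b : R) (k : nat) : {poly R} :=
  \sum_(j < k.+1) (gbinom (k%:R + a) (k - j) * gbinom (k%:R + b) j) *:
    ((2^-1 *: ('X - 1)) ^+ j * (2^-1 *: ('X + 1)) ^+ (k - j)).

Definition moment (R : realType) (a b : R) (f : R -> R) : R :=
  \int[@lebesgue_measure R]_(x in `[-1, 1]) (f x * jweight a b x).

Definition segint (R : realType) (w : R -> R) (l r : R) (f : R -> R) : R :=
  \int[@lebesgue_measure R]_(x in `[l, r]) (f x * w x).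

Definition segdiff (R : realType) (w : R -> R) (l r : R) (f : R -> R) : R :=
  segint w l r (derive1 f).

(* The family of segments is [l i, r i], i : 'I_N, with 0 < N. *)
Definition admissible (R : realType) (N : nat) (w : R -> R)
    (l r : 'I_N -> R) : Prop :=
  bijective (fun q : Pi R N.-1 =>
    \col_(i < N) segint w (l i) (r i) (horner q) : 'cV[R]_N).

(* npolyp only truncates above degree N, so that these are P_1, ..., P_N. *)
Definition jacobi_span (R : realType) (a b : R) (N : nat) :
    {vspace Pi R N} :=
  <<[tuple npolyp N.+1 (jacobi a b k.+1) | k < N]>>%VS.

Definition Jmap (R : realType) (al be ga de : R) (N : nat) (l r : 'I_N -> R)
    (p : Pi R N) : 'cV[R]_(1 + N) :=
  col_mx (\col_(_ < 1) moment al be (horner p))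
         (\col_(i < N) segdiff (jweight ga de) (l i) (r i) (horner p)).

Definition Dblock (R : realType) (ga de : R) (N : nat) (l r : 'I_N -> R)
    (Phi : N.-tuple (Pi R N)) : 'M[R]_N :=
  \matrix_(i, k) segdiff (jweight ga de) (l i) (r i) (horner (tnth Phi k)).

Definition cons1 (R : realType) (N : nat) (Phi : N.-tuple (Pi R N)) :
    (1 + N).-tuple (Pi R N) :=
  [tuple of npolyp N.+1 1 :: Phi].

Definition canon_basis (R : realType) (n : nat) : n.-tuple 'cV[R]_n :=
  [tuple delta_mx i 0 | i < n].

(* Column j holds the coordinates in e' of the image of the j-th vector of e
   (e and e' being bases). The library's passmx.mxof is the transposed,
   row-vector convention, restricted to tuples of length exactly \dim. *)
Definition mx_of_lin (R : realType) (U V : vectType R) (m n : nat)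
    (e : m.-tuple U) (e' : n.-tuple V) (f : 'Hom(U, V)) : 'M[R]_(n, m) :=
  \matrix_(i, j) coord e' i (f (tnth e j)).

(* Main.v *)
(* The matrix of the derivative moments on V can be made the identity: since the
   Jacobi polynomials of positive degree have zero moment while 1 does not,
   V contains no nonzero constant, so p |-> p' maps V isomorphically onto
   Pi_(N-1), and by admissibility p |-> (D_i p)_i maps V isomorphically onto R^N.
   Taking for Phi the preimages of the canonical basis gives D_Phi = I, which is
   trivially orthogonal.
   That P_k has zero moment for k > 0 comes from
     d/dx ((1-x)^(a+1) (1+x)^(b+1) P_(k-1)^(a+1,b+1)) = -2k (1-x)^a (1+x)^b P_k^(a,b),
   the function being differentiated vanishing at both endpoints. *)

Require Import Defs.
From HB Require Import structures.
From mathcomp Require Import all_boot all_order all_algebra.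
From mathcomp Require Import all_classical all_reals all_analysis.
From mathcomp Require Import measurable_realfun ring lra.

Import Order.TTheory GRing.Theory Num.Theory.
Import numFieldNormedType.Exports.

Local Open Scope ring_scope.

Lemma powR_shift_cvg0 (R : realType) (c p : R) : 0 < p ->
  ((x - c) `^ p @[x --> c^'+] --> (0 : R))%classic.
Proof.
move=> p0 P; move/(powR_cvg0 p0) => P0; apply/nbhs_right0P.
have {}P0 : \forall e \near ((0:R)^'+)%classic, P (e `^ p) by exact: P0.
near=> e; rewrite /= addrAC subrr add0r; near: e; exact: P0.
Unshelve. all: by end_near. Qed.

(** * Fundamental theorem of calculus on an open interval, with one-sided limits at the ends *)

Section improper.
Context {R : realType} (a b : R).
Hypothesis ab : a < b.
Let mu := @lebesgue_measure R.
(** The offset 3 gives [e n <= (b - a) / 3], so that [E n] is a nondegenerate compact interval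
    already for [n = 0]. *)
Let e (n : nat) : R := (b - a) / n.+3%:R.
Let E (n : nat) : set R := `[a + e n, b - e n]%classic.

Let e_gt0 n : 0 < e n.
Proof. by rewrite divr_gt0 ?subr_gt0. Qed.

Let e_lt n : a + e n < b - e n.
Proof.
have H : e n * n.+3%:R = b - a by rewrite /e divfK ?pnatr_eq0.
have : e n * 3%:R <= e n * n.+3%:R by rewrite ler_pM2l// ler_nat.
have := e_gt0 n; rewrite H; lra.
Qed.

Let e_le m n : (m <= n)%N -> e n <= e m.
Proof.
by move=> mn; rewrite ler_pM2l ?subr_gt0// lef_pV2 ?posrE ?ltr0n// ler_nat.
Qed.

Let e_cvg : (e n @[n --> \oo] --> (0 : R))%classic.
Proof.
rewrite -(mulr0 (b - a)); apply: cvgMl_tmp.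
have := @cvg_harmonic R; rewrite -(cvg_shiftn 2).
by under eq_cvg do rewrite /= addn2.
Qed.

Let near_E x : x \in `]a, b[ -> \forall n \near \oo%classic, E n x.
Proof.
rewrite in_itv/= => /andP[ax xb].
have := e_cvg => /cvgr_lt; rewrite -/e => H.
near=> n; rewrite /E/= in_itv/=.
have H1 : e n < x - a by near: n; apply: H; rewrite subr_gt0.
have H2 : e n < b - x by near: n; apply: H; rewrite subr_gt0.
lra.
Unshelve. all: by end_near. Qed.

Let E_oo n : (E n `<=` `]a, b[)%classic.
Proof.
move=> x; rewrite /E/= !in_itv/= => /andP[].
by have := e_gt0 n; lra.
Qed.

Let bigcupE : (\bigcup_n E n = `]a, b[)%classic.
Proof.
apply/seteqP; split=> [x [n _]|x xab]; first exact: E_oo.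
by have [n _ En] := near_E x xab; exists n => //; apply: En => /=.
Qed.

Context (f F : R -> R) (A B : R).
Hypothesis cf : {in `]a, b[, continuous f}.
Hypothesis dF : {in `]a, b[, forall x, is_derive x (1 : R) F (f x)}.
Hypothesis FA : (F x @[x --> a^'+] --> A)%classic.
Hypothesis FB : (F x @[x --> b^'-] --> B)%classic.

Let mf : measurable_fun `]a, b[%classic f.
Proof.
by apply: open_continuous_measurable_fun => // x; rewrite inE; exact: cf.
Qed.

Let integral_E n :
  (\int[mu]_(x in E n) (f x)%:E = (F (b - e n))%:E - (F (a + e n))%:E)%E.
Proof.
have sub x : x \in `[a + e n, b - e n] -> x \in `]a, b[ by exact: E_oo.
apply: continuous_FTC2 => //.
- apply: continuous_in_subspaceT => x; rewrite inE => /E_oo; exact: cf.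
- have cF x : x \in `]a, b[ -> {for x, continuous F}.
    move=> xab; apply: differentiable_continuous; apply/derivable1_diffP.
    by have [] := dF x xab.
  split.
  + by move=> x /subset_itv_oo_cc/sub xab; have [] := dF x xab.
  + apply: cvg_at_right_filter; apply: cF; apply: sub.
    by rewrite in_itv/= lexx ltW.
  + apply: cvg_at_left_filter; apply: cF; apply: sub.
    by rewrite in_itv/= lexx ltW.
- move=> x /subset_itv_oo_cc/sub xab; rewrite derive1E.
  by have [_ ->] := dF x xab.
Qed.

Let cvg_integral_E :
  ((\int[mu]_(x in E n) (f x)%:E)%E @[n --> \oo] --> (B - A)%:E)%classic.
Proof.
under eq_cvg do rewrite integral_E -EFinB.
apply: cvg_EFin; first exact: nearW.
apply: (@cvgB _ _ _ _ _ (fun n => F (b - e n)) (fun n => F (a + e n))).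
- move/cvg_at_leftP : FB; apply; split; first by move=> n; rewrite gtrBl.
  by rewrite -[X in (_ --> X)%classic]subr0; apply: cvgB; [exact: cvg_cst|].
- move/cvg_at_rightP : FA; apply; split; first by move=> n; rewrite ltrDl.
  by rewrite -[X in (_ --> X)%classic]addr0; apply: cvgD; [exact: cvg_cst|].
Qed.

(** Monotone convergence along the exhaustion [E n]. Integrability is not assumed, so this can
    establish it for powers that are singular at an endpoint. *)
Lemma ge0_integral_FTC2_oo : {in `]a, b[, forall x, 0 <= f x} ->
  (\int[mu]_(x in `]a, b[) (f x)%:E = (B - A)%:E)%E.
Proof.
move=> f0.
rewrite -bigcupE; apply: cvg_unique cvg_integral_E => //.
apply: ge0_nondecreasing_set_cvg_integral => //.
- move=> m n mn; apply/subsetPset => x; rewrite /E/= !in_itv/= => /andP[].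
  by have := e_le _ _ mn; lra.
- by move=> n; exact: measurable_itv.
- move=> n; apply/measurable_EFinP; apply: (measurable_funS _ (@E_oo n)) mf.
  exact: measurable_itv.
- by move=> n x /E_oo xab; rewrite lee_fin f0.
Qed.

(** For integrands that change sign, dominated convergence with bound [|f|] replaces monotone
    convergence. *)
Lemma Rintegral_FTC2_oo : mu.-integrable `]a, b[%classic (EFin \o f) ->
  \int[mu]_(x in `]a, b[) f x = B - A.
Proof.
move=> fi; rewrite -[RHS]/(fine (B - A)%:E); congr fine.
apply: cvg_unique cvg_integral_E => //.
(* Extension by zero puts all integrals on one domain; at each point the extended integrands are
   eventually constant, equal to [f x]. *)
have -> : (fun n => \int[mu]_(x in E n) (f x)%:E)%E =
   (fun n => \int[mu]_(x in `]a, b[) ((EFin \o f) \_ (E n)) x)%E.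
  apply/funext => n; rewrite -integral_mkcondr; congr integral.
  by apply/esym/setIidPr; exact: E_oo.
apply: (@dominated_cvg _ _ _ mu _ (measurable_itv _) _ _
  (fun x => `|(f x)%:E|%E)) => //.
- move=> n; apply/(measurable_restrict _ _ _) => //.
  + exact: measurable_itv.
  + apply/measurable_EFinP; exact: (measurable_funS _ (@subIsetl _ _ _) mf).
- move=> x xab; apply: cvg_near_cst; have := near_E x xab.
  apply: filterS => n En; by rewrite /= patchE mem_set.
- exact: integrable_abse.
- move=> n x xab; rewrite patchE; case: ifP => //.
  by rewrite abse0 abse_ge0.
Qed.

End improper.

(** * Integrability of the Jacobi weight *)

Section weight.
Context {R : realType}.
Local Notation mu := (@lebesgue_measure R).
Implicit Types a b p x : R.

Lemma is_derive_powR_shift c p x : c < x ->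
  is_derive x (1 : R) (fun y => (y - c) `^ p) (p * (x - c) `^ (p - 1)).
Proof.
move=> cx; rewrite -[X in is_derive _ _ _ X]mulr1.
apply: (@is_derive1_comp _ (fun y => y `^ p) (fun y => y - c)).
  by apply: is_derive1_powR; rewrite subr_gt0.
by rewrite -[X in is_derive _ _ _ X]subr0; exact: is_deriveB.
Qed.

Lemma is_derive_powR_reflect c p x : x < c ->
  is_derive x (1 : R) (fun y => (c - y) `^ p) (- (p * (c - x) `^ (p - 1))).
Proof.
move=> cx; rewrite -[X in is_derive _ _ _ X]mulrN1.
apply: (@is_derive1_comp _ (fun y => y `^ p) (fun y => c - y)).
  by apply: is_derive1_powR; rewrite subr_gt0.
by rewrite -[X in is_derive _ _ _ X]sub0r; exact: is_deriveB.
Qed.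

Lemma powR_reflect_cvg0 (c p : R) : 0 < p ->
  ((c - x) `^ p @[x --> c^'-] --> (0 : R))%classic.
Proof.
move=> p0; apply/cvg_at_leftNP.
have := @powR_shift_cvg0 R (- c) p p0.
by apply: cvg_trans; apply: near_eq_cvg; near=> x; rewrite /= !opprK addrC.
Unshelve. all: by end_near. Qed.

Lemma continuous_powR_shift c p x : c < x ->
  {for x, continuous (fun y => (y - c) `^ p)}.
Proof.
move=> cx; apply: differentiable_continuous; apply/derivable1_diffP.
by have [] := is_derive_powR_shift c p x cx.
Qed.

Lemma continuous_powR_reflect c p x : x < c ->
  {for x, continuous (fun y => (c - y) `^ p)}.
Proof.
move=> cx; apply: differentiable_continuous; apply/derivable1_diffP.
by have [] := is_derive_powR_reflect c p x cx.
Qed.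

Lemma measurable_powR_shift c p (D : set R) :
  measurable_fun D (fun y => (y - c) `^ p).
Proof.
apply: measurable_funTS; apply: (measurableT_comp (measurable_powR p)).
by apply: measurable_funB.
Qed.

Lemma measurable_powR_reflect c p (D : set R) :
  measurable_fun D (fun y => (c - y) `^ p).
Proof.
apply: measurable_funTS; apply: (measurableT_comp (measurable_powR p)).
by apply: measurable_funB.
Qed.

(** The antiderivative [(x - a)^(p+1) / (p+1)] tends to 0 at [a] because [p + 1 > 0], so the
    integral is finite. *)
Lemma integrable_powR_shift (a b p : R) : a < b -> -1 < p ->
  mu.-integrable `]a, b[%classic (fun x => ((x - a) `^ p)%:E).
Proof.
move=> ab p1; have q0 : 0 < p + 1 by lra.
apply/integrableP; split.
  by apply/measurable_EFinP; exact: measurable_powR_shift.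
under eq_integral do rewrite gee0_abs ?lee_fin ?powR_ge0//.
rewrite (@ge0_integral_FTC2_oo _ a b ab (fun x => (x - a) `^ p)
  (fun x => (p + 1)^-1 * (x - a) `^ (p + 1)) 0
  ((p + 1)^-1 * (b - a) `^ (p + 1))) ?ltry//.
- by move=> x; rewrite in_itv/= => /andP[ax _]; exact: continuous_powR_shift.
- move=> x; rewrite in_itv/= => /andP[ax _].
  have -> : (x - a) `^ p = (p + 1)^-1 * ((p + 1) * (x - a) `^ (p + 1 - 1)).
    by rewrite mulKf ?gt_eqF// addrK.
  by apply: is_deriveZ; exact: is_derive_powR_shift.
- rewrite -[X in (_ --> X)%classic](mulr0 (p + 1)^-1).
  by apply: cvgMl_tmp; exact: powR_shift_cvg0.
- apply: cvg_at_left_filter; apply: cvgMl_tmp.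
  exact: continuous_powR_shift.
- by move=> x _; exact: powR_ge0.
Qed.

Lemma integrable_powR_reflect (a b p : R) : a < b -> -1 < p ->
  mu.-integrable `]a, b[%classic (fun x => ((b - x) `^ p)%:E).
Proof.
move=> ab p1; have q0 : 0 < p + 1 by lra.
apply/integrableP; split.
  by apply/measurable_EFinP; exact: measurable_powR_reflect.
under eq_integral do rewrite gee0_abs ?lee_fin ?powR_ge0//.
rewrite (@ge0_integral_FTC2_oo _ a b ab (fun x => (b - x) `^ p)
  (fun x => - (p + 1)^-1 * (b - x) `^ (p + 1))
  (- (p + 1)^-1 * (b - a) `^ (p + 1)) 0) ?ltry//.
- by move=> x; rewrite in_itv/= => /andP[_ ax]; exact: continuous_powR_reflect.
- move=> x; rewrite in_itv/= => /andP[_ ax].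
  have -> : (b - x) `^ p = - (p + 1)^-1 * - ((p + 1) * (b - x) `^ (p + 1 - 1)).
    by rewrite mulrNN mulKf ?gt_eqF// addrK.
  by apply: is_deriveZ; exact: is_derive_powR_reflect.
- apply: cvg_at_right_filter; apply: cvgMl_tmp.
  exact: continuous_powR_reflect.
- rewrite -[X in (_ --> X)%classic](mulr0 (- (p + 1)^-1)).
  by apply: cvgMl_tmp; exact: powR_reflect_cvg0.
- by move=> x _; exact: powR_ge0.
Qed.

(** The maximum on [[1, 2]] is [2^b] or 1 according to the sign of [b]; the sum covers both
    cases. *)
Lemma powR_12_le (b x : R) : 1 <= x <= 2 -> x `^ b <= 1 + 2 `^ b.
Proof.
move=> /andP[x1 x2]; have [b0|b0] := leP 0 b.
  apply: (@le_trans _ _ (2 `^ b)); last by rewrite lerDr.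
  by apply: ge0_ler_powR => //; rewrite nnegrE; lra.
apply: (@le_trans _ _ 1); last by rewrite lerDl powR_ge0.
by rewrite -(powRr0 x) ler_powR// ltW.
Qed.

(** On each half of the interval one factor has its base in [[1, 2]] and is bounded, and the other
    carries the singularity. The sum dominates on both halves, and each summand is an integrable
    power. *)
Lemma jweight_le a b x : -1 < x < 1 ->
  jweight a b x <= (1 + 2 `^ b) * (1 - x) `^ a + (1 + 2 `^ a) * (x - -1) `^ b.
Proof.
move=> /andP[x1 x2]; rewrite /jweight opprK (addrC x).
have [x0|x0] := leP 0 x.
  rewrite (le_trans (y := (1 + 2 `^ b) * (1 - x) `^ a))//.
    rewrite mulrC ler_wpM2r ?powR_ge0// powR_12_le//; lra.
  by rewrite lerDl mulr_ge0 ?powR_ge0// addr_ge0 ?powR_ge0.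
rewrite (le_trans (y := (1 + 2 `^ a) * (1 + x) `^ b))//.
  rewrite ler_wpM2r ?powR_ge0// powR_12_le//; lra.
by rewrite lerDr mulr_ge0 ?powR_ge0// addr_ge0 ?powR_ge0.
Qed.

Lemma jweight_ge0 a b x : 0 <= jweight a b x.
Proof. by rewrite mulr_ge0 ?powR_ge0. Qed.

Lemma measurable_jweight a b (D : set R) : measurable_fun D (jweight a b).
Proof.
apply: measurable_funM; first exact: measurable_powR_reflect.
under eq_fun do rewrite addrC -[X in _ + X]opprK.
exact: measurable_powR_shift.
Qed.

Lemma integrable_jweight_oo a b : -1 < a -> -1 < b ->
  mu.-integrable `](-1), 1[%classic (EFin \o jweight a b).
Proof.
move=> a1 b1.
have ltN11 : -1 < 1 :> R by lra.
pose g x : \bar R := ((1 + 2 `^ b)%:E * ((1 - x) `^ a)%:E +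
  (1 + 2 `^ a)%:E * ((x - -1) `^ b)%:E)%E.
have gi : mu.-integrable `](-1), 1[%classic g.
  apply: integrableD => //; apply: integrableZl => //.
    exact: integrable_powR_reflect.
  exact: integrable_powR_shift.
apply: le_integrable gi => //.
- by apply/measurable_EFinP; exact: measurable_jweight.
- move=> x; rewrite /= in_itv/= => x1.
  rewrite lee_fin ger0_norm ?jweight_ge0//.
  by apply: le_trans (ler_norm _); exact: jweight_le.
Qed.

Lemma integrable_jweight a b : -1 < a -> -1 < b ->
  mu.-integrable `[-1, 1]%classic (EFin \o jweight a b).
Proof.
move=> a1 b1; have /integrableP[_ foo] := integrable_jweight_oo _ _ a1 b1.
apply/integrableP; split.
  by apply/measurable_EFinP; exact: measurable_jweight.
rewrite integral_itv_bndoo//; apply: measurableT_comp => //.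
by apply/measurable_EFinP; exact: measurable_jweight.
Qed.

(** A polynomial is bounded on the compact [[-1, 1]], and a bounded measurable factor preserves
    integrability; the result then restricts to [[l, r]]. *)
Lemma integrable_horner_jweight a b (l r : R) (p : {poly R}) :
    -1 < a -> -1 < b -> -1 <= l -> r <= 1 ->
  mu.-integrable `[l, r]%classic (EFin \o (fun x => p.[x] * jweight a b x)).
Proof.
move=> a1 b1 l1 r1.
suff : mu.-integrable (`[-1, 1]%classic : set R)
    (EFin \o (fun x => p.[x] * jweight a b x)).
  by apply: integrableS => //; apply: subset_itv; rewrite bnd_simp.
have mp : measurable_fun (`[-1, 1]%classic : set R) (horner p).
  apply: measurable_funTS; apply: continuous_measurable_fun.
  exact: continuous_horner.
have -> : EFin \o (fun x => p.[x] * jweight a b x) =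
    ((EFin \o horner p) \* (EFin \o jweight a b))%E by [].
apply: integrableMr => //; last exact: integrable_jweight.
have /compact_bounded : compact (horner p @` `[-1, 1])%classic.
  apply: continuous_compact (@segment_compact _ _ _).
  apply: continuous_subspaceT; exact: continuous_horner.
move=> [M [Mr HM]]; exists M; split => // y My x x1; apply: (HM y My); by exists x.
Qed.

End weight.

(** * Generalized binomials and the derivative formula for Jacobi polynomials *)

Lemma gbinomS (R : realType) (x : R) n :
  n.+1%:R * gbinom x n.+1 = (x - n%:R) * gbinom x n.
Proof.
have N0 : n.+1%:R != 0 :> R by rewrite pnatr_eq0.
have F0 : n`!%:R != 0 :> R by rewrite pnatr_eq0 -lt0n fact_gt0.
rewrite /gbinom big_ord_recr/= factS natrM; move: N0 F0.
move: (n.+1%:R : R) (n`!%:R : R) (\prod_(i < n) _) => N f P N0 f0.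
by field; rewrite ?N0 ?f0.
Qed.

Lemma gbinom_gt0 (R : realType) (x : R) n : n%:R < x + 1 -> 0 < gbinom x n.
Proof.
move=> nx; rewrite divr_gt0 ?ltr0n ?fact_gt0// prodr_gt0// => i _.
have : i.+1%:R <= n%:R :> R by rewrite ler_nat.
rewrite -natr1; lra.
Qed.

(** The extra factor [p] restores the exponent lowered by differentiation, so [n = 0] needs no
    separate form. It is applied to [(x-1)/2] and [(x+1)/2]. *)
Lemma mul_deriv_exp_half (R : realType) (p : {poly R}) n :
  p^`() = (2^-1)%:P -> 2 *: (p * (p ^+ n)^`()) = n%:R *: p ^+ n.
Proof.
move=> dp; case: n => [|n]; first by rewrite expr0 derivC mulr0 scaler0 scale0r.
rewrite deriv_exp dp mulrnAr mul_polyC -scalerAr -exprS scalerMnr scalerA.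
by rewrite mulfV ?pnatr_eq0// scale1r scaler_nat.
Qed.

(* Since 1 - x = -2U and 1 + x = 2V, this is the derivative formula above with
   the weight cancelled. *)
Lemma jacobi_deriv_eq (R : realType) (a b : R) k :
  let U : {poly R} := 2^-1 *: ('X - 1) in
  let V : {poly R} := 2^-1 *: ('X + 1) in
  let Q := jacobi (a + 1) (b + 1) k in
  2 *: (U * V * Q^`()) + ((b + 1) *: U + (a + 1) *: V) * Q =
  k.+1%:R *: jacobi a b k.+1.
Proof.
move=> U V Q.
have d1 : (1 : {poly R})^`() = 0 by rewrite -polyC1 derivC.
have dU : U^`() = (2^-1)%:P.
  by rewrite /U derivZ derivB derivX d1 subr0 alg_polyC.
have dV : V^`() = (2^-1)%:P.
  by rewrite /V derivZ derivD derivX d1 addr0 alg_polyC.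
(* [c] holds the coefficients of the polynomial of degree [k+1] with parameters [a, b], and [d]
   those of [Q]; since [k + (a+1) = (k+1) + a], both use the same upper arguments. *)
pose c j := gbinom (k.+1%:R + a) (k.+1 - j) * gbinom (k.+1%:R + b) j.
pose d j := gbinom (k.+1%:R + a) (k - j) * gbinom (k.+1%:R + b) j.
pose T j := U ^+ j * V ^+ (k.+1 - j).
have QE : Q = \sum_(j < k.+1) d j *: (U ^+ j * V ^+ (k - j)).
  apply: eq_bigr => j _; congr (_ *: _); rewrite /d -natr1.
  by congr (gbinom _ _ * gbinom _ _); ring.
(* The [j]-th term of [Q] feeds only the neighbours [T j] and [T j.+1], with weights
   [d j * (j + a + 1)] and [d j * (k - j + b + 1)]; [gbinomS] turns these into multiples of [c j]
   and [c j.+1]. *)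
have term (j : 'I_k.+1) : 2 *: (U * V * (d j *: (U ^+ j * V ^+ (k - j)))^`()) +
   ((b + 1) *: U + (a + 1) *: V) * (d j *: (U ^+ j * V ^+ (k - j))) =
   ((k.+1 - j)%:R * c j) *: T j + (j.+1%:R * c j.+1) *: T j.+1.
  have jk : (j <= k)%N by rewrite -ltnS.
  have -> : (k.+1 - j)%:R * c j = d j * (j%:R + a + 1).
    rewrite /c /d subSn// mulrA gbinomS natrB// -natr1; ring.
  have -> : j.+1%:R * c j.+1 = d j * ((k - j)%:R + b + 1).
    rewrite /c /d subSS mulrCA gbinomS natrB// -natr1; ring.
  rewrite /T subSS subSn// !exprS derivZ derivM.
  have := mul_deriv_exp_half _ _ j dU; have := mul_deriv_exp_half _ _ (k - j) dV.
  set X := U ^+ j; set Y := V ^+ (k - j); set X' := X^`(); set Y' := Y^`().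
  move=> eY eX.
  transitivity (d j *: (V * Y * (2 *: (U * X')) + U * X * (2 *: (V * Y'))) +
    ((b + 1) *: U + (a + 1) *: V) * (d j *: (X * Y))).
    by rewrite -!mul_polyC; ring.
  by rewrite eX eY -!mul_polyC !rmorphM/= !rmorphD/= rmorph1; ring.
rewrite QE raddf_sum/= 2!mulr_sumr scaler_sumr -big_split/=.
rewrite (eq_bigr _ (fun j _ => term j)) big_split/=.
(* Both sums extend to [j <= k+1], as the added term has factor 0 (at [j = k+1] here, at [j = 0] in
   the shifted sum). The factors then add up to [(k+1-j) + j = k+1]. *)
have -> : \sum_(j < k.+1) ((k.+1 - j)%:R * c j) *: T j =
    \sum_(j < k.+2) ((k.+1 - j)%:R * c j) *: T j.
  by rewrite [RHS]big_ord_recr/= subnn mul0r scale0r addr0.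
have -> : \sum_(j < k.+1) (j.+1%:R * c j.+1) *: T j.+1 =
    \sum_(j < k.+2) (j%:R * c j) *: T j.
  by rewrite [RHS]big_ord_recl/= mul0r scale0r add0r.
rewrite -big_split/= /jacobi scaler_sumr; apply: eq_bigr => j _.
by rewrite -scalerDl -mulrDl -natrD subnK ?scalerA// -ltnS.
Qed.

(** * Degree and leading coefficient of Jacobi polynomials *)

Section jacobi_coefs.
Context {R : realType} (a b : R).

Let term k j : {poly R} := (2^-1 *: ('X - 1)) ^+ j * (2^-1 *: ('X + 1)) ^+ (k - j).

Let size_term k j : (j <= k)%N -> size (term k j) = k.+1 /\ (term k j)`_k = 2^-1 ^+ k.
Proof.
move=> jk.
have -> : term k j = 2^-1 ^+ k *: (('X - 1%:P) ^+ j * ('X - (-1)%:P) ^+ (k - j)).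
  rewrite /term polyCN opprK polyC1 !exprZn -scalerAl -scalerAr scalerA -exprD.
  by rewrite subnKC.
set q := _ * _.
have mq : q \is monic by rewrite monicMl ?monic_exp ?monicXsubC.
have sq : size q = k.+1.
  rewrite size_Mmonic ?monic_neq0 ?monic_exp ?monicXsubC// !size_exp_XsubC.
  by rewrite addSn addnS/= subnKC.
split; first by rewrite size_scale// expf_neq0 ?invr_neq0 ?pnatr_eq0.
by rewrite coefZ -[k in q`_k]/(k.+1.-1) -sq -lead_coefE (monicP mq) mulr1.
Qed.

Lemma size_jacobi_le k : (size (jacobi a b k) <= k.+1)%N.
Proof.
apply: (leq_trans (size_sum _ _ _)); apply/bigmax_leqP => j _.
apply: (leq_trans (size_scale_leq _ _)).
by have [-> _] := size_term k j (ltn_ord j : j <= k)%N.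
Qed.

(** Every term has leading coefficient [2^-k] times two generalized binomials, which are positive
    for [a, b > -1]; hence nothing cancels and the degree is exactly [k]. *)
Lemma coef_jacobi_gt0 k : -1 < a -> -1 < b -> 0 < (jacobi a b k)`_k.
Proof.
move=> a1 b1.
have pos (j : 'I_k.+1) : 0 < ((gbinom (k%:R + a) (k - j) * gbinom (k%:R + b) j) *:
    term k j)`_k.
  have jk : (j <= k)%N by rewrite -ltnS.
  have jkR : j%:R <= k%:R :> R by rewrite ler_nat.
  have [_ ck] := size_term k j jk; rewrite coefZ ck.
  rewrite mulr_gt0 ?exprn_gt0 ?invr_gt0// mulr_gt0 ?gbinom_gt0//.
    rewrite natrB//; have j0 : 0 <= j%:R :> R by exact: ler0n.
    move: a1 j0; move: (j%:R : R) (k%:R : R) => s t; lra.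
  move: b1 jkR; move: (j%:R : R) (k%:R : R) => s t; lra.
rewrite coef_sum big_ord_recl; apply: ltr_pwDl; first exact: pos.
by apply: sumr_ge0 => j _; exact: ltW (pos _).
Qed.

End jacobi_coefs.

(** * Moments of Jacobi polynomials and of the constant 1 *)

Section moments.
Context {R : realType} (a b : R).
Local Notation mu := (@lebesgue_measure R).

Lemma jweightE (p q : R) :
  jweight p q = (fun x => (1 - x) `^ p) * (fun x => (x - -1) `^ q).
Proof. by apply/funext => x; rewrite /jweight opprK [1 + x]addrC. Qed.

Lemma continuous_jweight (p q x : R) : -1 < x < 1 ->
  {for x, continuous (jweight p q)}.
Proof.
move=> /andP[x1 x2]; rewrite jweightE; apply: cvgM.
  exact: continuous_powR_reflect.
exact: continuous_powR_shift.
Qed.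

(** Differentiation lowers one exponent at a time, so each term of the product rule still contains
    the weight with exponents [a, b], which is factored out. *)
Lemma is_derive_jweight_horner (Q : {poly R}) (x : R) :
    -1 < a -> -1 < b -> -1 < x < 1 ->
  is_derive x (1 : R) (fun y => jweight (a + 1) (b + 1) y * Q.[y])
   (((1 - x) * (1 + x) * Q^`().[x] +
     ((b + 1) * (1 - x) - (a + 1) * (1 + x)) * Q.[x]) * jweight a b x).
Proof.
move=> a1 b1 /andP[x1 x2].
have dl := @is_derive_powR_reflect R 1 (a + 1) x x2.
have dr := @is_derive_powR_shift R (-1) (b + 1) x x1.
have dQ := is_derive_poly Q x.
have wE p q : jweight p q x = (1 - x) `^ p * (x - -1) `^ q by rewrite jweightE.
rewrite wE jweightE; apply: is_derive_eq.
rewrite /GRing.scale/= !addrK !fctE.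
have -> : (1 - x) `^ (a + 1) = (1 - x) * (1 - x) `^ a.
  rewrite -[X in (1 - x) * _ `^ X](@addrK _ 1 a) mulr_powRB1//.
    by rewrite subr_ge0 ltW.
  by rewrite -ltrBlDr sub0r.
have -> : (x - -1) `^ (b + 1) = (x - -1) * (x - -1) `^ b.
  rewrite -[X in (x - -1) * _ `^ X](@addrK _ 1 b) mulr_powRB1//.
    by rewrite subr_ge0 ltW.
  by rewrite -ltrBlDr sub0r.
ring.
Qed.

Lemma moment_jacobi k : -1 < a -> -1 < b ->
  moment a b (horner (jacobi a b k.+1)) = 0.
Proof.
move=> a1 b1.
have ltN11 : -1 < 1 :> R by lra.
have ap : 0 < a + 1 by lra.
have bp : 0 < b + 1 by lra.
set P := jacobi a b k.+1; set Q := jacobi (a + 1) (b + 1) k.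
(* [P2] is -2 times either side of [jacobi_deriv_eq]: in terms of [U = (x-1)/2] and [V = (x+1)/2],
   [(1-x)(1+x) = -4UV]. Thus [P2] times the weight is an exact derivative. *)
pose P2 := (- (2 * k.+1%:R)) *: P.
have P2E (x : R) : P2.[x] = (1 - x) * (1 + x) * Q^`().[x] +
     ((b + 1) * (1 - x) - (a + 1) * (1 + x)) * Q.[x].
  have := congr1 (horner^~ x) (jacobi_deriv_eq _ a b k); rewrite /= -/Q -/P.
  have h1 : (1 : {poly R}).[x] = 1 by rewrite -polyC1 hornerC.
  rewrite /P2 !(hornerD, hornerM, hornerZ, hornerN, hornerX) h1 => H.
  have -> : - (2 * k.+1%:R) * P.[x] = -2 * (k.+1%:R * P.[x]) by ring.
  by rewrite -H; field.
have int (p : {poly R}) :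
    mu.-integrable (`[-1, 1]%classic : set R)
      (EFin \o (fun x => p.[x] * jweight a b x)).
  exact: integrable_horner_jweight.
have : moment a b (horner P2) = 0.
  rewrite /moment /Rintegral integral_itv_bndoo; last first.
    apply/measurable_EFinP; apply: measurable_funM; last exact: measurable_jweight.
    apply: measurable_funTS; apply: continuous_measurable_fun.
    exact: continuous_horner.
  rewrite -/(Rintegral _ _ _) (@Rintegral_FTC2_oo _ (-1) 1 _ _
    (fun y => jweight (a + 1) (b + 1) y * Q.[y]) 0 0) ?subrr//.
  - move=> x; rewrite in_itv/= => x1; apply: cvgM; first exact: continuous_horner.
    exact: continuous_jweight.
  - move=> x; rewrite in_itv/= => x1; rewrite P2E.
    exact: is_derive_jweight_horner.
  (* At each endpoint one weight factor tends to 0, its exponent [a + 1] or [b + 1] being positive,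
     while the other factors have finite limits. *)
  - rewrite -(mul0r Q.[-1]); apply: cvgM; last first.
      apply: cvg_at_right_filter; exact: continuous_horner.
    rewrite -(mulr0 ((1 - -1) `^ (a + 1))) jweightE; apply: cvgM.
      apply: cvg_at_right_filter; exact: continuous_powR_reflect.
    exact: powR_shift_cvg0.
  - rewrite -(mul0r Q.[1]); apply: cvgM; last first.
      apply: cvg_at_left_filter; exact: continuous_horner.
    rewrite -(mul0r ((1 - -1) `^ (b + 1))) jweightE; apply: cvgM.
      exact: powR_reflect_cvg0.
    apply: cvg_at_left_filter; exact: continuous_powR_shift.
  - apply: integrableS (int P2) => //; exact: subset_itv_oo_cc.
have -> : moment a b (horner P2) = - (2 * k.+1%:R) * moment a b (horner P).
  rewrite /moment -(RintegralZl _ _ (int P))//.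
  by apply: eq_Rintegral => x _; rewrite /P2 hornerZ -mulrA.
by move/eqP; rewrite mulf_eq0 oppr_eq0 mulf_eq0 !pnatr_eq0 => /eqP.
Qed.

(** A zero integral would force the nonnegative weight to vanish almost everywhere; being positive
    on []-1, 1[], it would make that interval, of length 2, negligible. *)
Lemma moment1_gt0 : -1 < a -> -1 < b -> 0 < moment a b (fun=> 1).
Proof.
move=> a1 b1.
have m1E : moment a b (fun=> 1) = \int[mu]_(x in `[-1, 1]) jweight a b x.
  by apply: eq_Rintegral => x _; rewrite mul1r.
rewrite lt_neqAle m1E Rintegral_ge0 ?andbT; last by move=> x _; exact: jweight_ge0.
apply/eqP => /esym I0.
have fi := integrable_jweight a b a1 b1.
have mw : measurable_fun (`]-1, 1[%classic : set R) (EFin \o jweight a b).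
  by apply/measurable_EFinP; exact: measurable_jweight.
have : (\int[mu]_(x in `](-1)%R, 1%R[) `|(EFin \o jweight a b) x| = 0)%E.
  under eq_integral do rewrite gee0_abs ?lee_fin ?jweight_ge0//.
  rewrite -(integral_itv_bndoo true false mw) -[LHS]fineK.
    by congr EFin.
  exact: integrable_fin_num.
move=> /(ae_eq_integral_abs mu (measurable_itv _) mw) w0.
have Nn : mu.-negligible (`]-1, 1[%classic : set R).
  apply: negligibleS w0 => x /= x1 /(_ x1) /eqP.
  move: x1; rewrite in_itv/= eqe => /andP[x1 x2].
  by rewrite gt_eqF// mulr_gt0// powR_gt0; lra.
have mu0 : mu (`]-1, 1[%classic : set R) = 0 by exact: measure_negligible.
have : mu (`]-1, 1[%classic : set R) = (1 - -1)%:E.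
  by rewrite lebesgue_measure_itv/= lte_fin ifT//; lra.
by rewrite mu0 => /eqP; rewrite eqe; lra.
Qed.

End moments.

(** * Linearity of the functionals, coordinates and the Jacobi span *)

Lemma segdiff_horner (R : realType) (w : R -> R) l r (p : {poly R}) :
  segdiff w l r (horner p) = segint w l r (horner p^`()).
Proof. by rewrite /segdiff -derivE. Qed.

Lemma segint0 (R : realType) (w : R -> R) l r : segint w l r (horner 0) = 0.
Proof.
rewrite /segint (@eq_Rintegral _ _ _ _ _ (fun=> 0)) ?Rintegral_cst ?mul0r//.
by move=> x _; rewrite horner0 mul0r.
Qed.

(** This also serves for [moment], which is by definition the case [l = -1], [r = 1]. *)
Lemma segint_linear (R : realType) (a b l r c : R) (p q : {poly R}) :
    -1 < a -> -1 < b -> -1 <= l -> r <= 1 ->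
  segint (jweight a b) l r (horner (c *: p + q)) =
  c * segint (jweight a b) l r (horner p) + segint (jweight a b) l r (horner q).
Proof.
move=> a1 b1 l1 r1.
have int s := integrable_horner_jweight a b l r s a1 b1 l1 r1.
rewrite /segint -(RintegralZl c _ (int p))//.
have intc := int (c *: p).
rewrite (_ : EFin \o _ = EFin \o (fun x => c * (p.[x] * jweight a b x)))
  in intc; last first.
  by apply/funext => x /=; rewrite hornerZ -mulrA.
rewrite -(RintegralD _ intc (int q))//.
by apply: eq_Rintegral => x _; rewrite hornerD hornerZ mulrDl -mulrA.
Qed.

Lemma linear_linfun (K : fieldType) (U V : vectType K) (f : U -> V) :
  linear f -> exists h : 'Hom(U, V), h =1 f.
Proof.
move=> lf; pose g : {linear U -> V} := HB.pack f (GRing.isLinear.Build _ _ _ _ f lf).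
by exists (linfun g) => x; rewrite lfunE.
Qed.

Lemma Jmap_linear (R : realType) (al be ga de : R) N (l r : 'I_N -> R) :
  -1 < al -> -1 < be -> -1 < ga -> -1 < de ->
  (forall i, [/\ -1 <= l i, l i < r i & r i <= 1]) ->
  linear (Jmap al be ga de l r).
Proof.
move=> hal hbe hga hde hs c p q.
rewrite /Jmap scale_col_mx add_col_mx; congr col_mx; apply/colP => i; rewrite !mxE.
  exact: segint_linear.
have [l1 _ r1] := hs i.
rewrite !segdiff_horner.
rewrite [(_ + _)^`()](_ : _ = c *: (p : {poly R})^`() + (q : {poly R})^`()).
  exact: segint_linear.
by rewrite -derivZ -derivD.
Qed.

Lemma canon_basis_coord (R : realType) n (v : 'cV[R]_n) i :
  coord (canon_basis R n) i v = v i 0.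
Proof.
have nthE (j : 'I_n) : (canon_basis R n)`_j = delta_mx j 0.
  by rewrite -tnth_nth tnth_mktuple.
have sumE (k : 'I_n -> R) : \sum_i k i *: (canon_basis R n)`_i = \col_i k i.
  apply/colP => j; rewrite summxE mxE (bigD1 j)//= big1 => [|m mj].
    by rewrite nthE !mxE !eqxx mulr1 addr0.
  by rewrite nthE !mxE eq_sym (negbTE mj) mulr0.
have fr : free (canon_basis R n).
  apply/freeP => k; rewrite sumE => /colP k0 j.
  by have := k0 j; rewrite !mxE.
have -> : v = \sum_j (v j 0) *: (canon_basis R n)`_j.
  by rewrite sumE; apply/colP => j; rewrite mxE.
by rewrite coord_sum_free// sumE mxE.
Qed.

Lemma npolyp_jacobiK (R : realType) (a b : R) N (k : 'I_N) :
  npolyp N.+1 (jacobi a b k.+1) = jacobi a b k.+1 :> {poly R}.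
Proof. by rewrite npolypK// (leq_trans (size_jacobi_le _ _ _))// ltnS. Qed.

(** The degrees are distinct: if [m] is the largest index with a nonzero coefficient, only that term
    contributes to degree [m.+1], since index [k] stands for the polynomial of degree [k.+1]. *)
Lemma jacobi_free (R : realType) (a b : R) N : -1 < a -> -1 < b ->
  free [tuple npolyp N.+1 (jacobi a b k.+1) | k < N].
Proof.
move=> a1 b1; apply/freeP => c c0 i; apply/eqP; apply: contraT => ci.
have [m cm mmax] := @arg_maxnP _ i (fun k => c k != 0) val ci.
have /(congr1 (fun p : Pi R N => (p : {poly R})`_m.+1)) := c0.
have term (k : 'I_N) :
    ((c k *: [tuple npolyp N.+1 (jacobi a b k.+1) | k < N]`_k : Pi R N)
      : {poly R})`_m.+1 =
    c k * (jacobi a b k.+1)`_m.+1.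
  rewrite -tnth_nth tnth_mktuple -[LHS]/((c k *: (npolyp _ _ : {poly R}))`_m.+1).
  by rewrite coefZ npolyp_jacobiK.
rewrite raddf_sum coef_sum (bigD1 m)//= big1 => [|k km]; last first.
  rewrite term; have [->|ck] := eqVneq (c k) 0; first by rewrite mul0r.
  rewrite nth_default ?mulr0// (leq_trans (size_jacobi_le _ _ _))// !ltnS.
  by rewrite ltn_neqAle (inj_eq val_inj) km; exact: mmax.
rewrite term addr0 coef0 => /eqP; rewrite mulf_eq0 (negbTE cm)/=.
by rewrite gt_eqF// coef_jacobi_gt0.
Qed.

Lemma moment_jacobi_span (R : realType) (a b : R) N (p : Pi R N) :
    -1 < a -> -1 < b ->
  p \in jacobi_span a b N -> moment a b (horner p) = 0.
Proof.
move=> a1 b1 /coord_span ->.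
(* [R^o] is [R] as a module over itself, which lets the moment be a linear map. *)
pose f (q : Pi R N) : R^o := moment a b (horner q).
have lf : linear f by move=> c q q'; exact: segint_linear.
pose g : {linear Pi R N -> R^o} := HB.pack f (GRing.isLinear.Build _ _ _ _ f lf).
rewrite -[LHS]/(g _) linear_sum big1// => k _; rewrite linearZ -tnth_nth tnth_mktuple/=.
by rewrite /f npolyp_jacobiK moment_jacobi ?scaler0.
Qed.

(** The derivative lies in the domain [Pi R N.-1] of the admissibility map, and there it has the
    same image as 0. *)
Lemma admissible_deriv_inj (R : realType) (w : R -> R) N (l r : 'I_N -> R)
    (p : {poly R}) :
    (0 < N)%N -> (size p <= N.+1)%N -> admissible w l r ->
  (forall i, segdiff w (l i) (r i) (horner p) = 0) -> p^`() = 0.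
Proof.
move=> N0 sp /bij_inj inj dp.
have sz : (size p^`() <= N.-1.+1)%N.
  rewrite prednK//; have [->|p0] := eqVneq p 0; first by rewrite deriv0 size_poly0.
  by rewrite -ltnS (leq_trans _ sp)// lt_size_deriv.
suff p0 : npolyp N.-1.+1 p^`() = 0 by rewrite -(npolypK sz) p0.
apply: inj; apply/colP => i; rewrite !mxE npolypK//.
by rewrite -segdiff_horner dp segint0.
Qed.

(** * Construction of the basis and of the block matrix *)

Theorem corollary4 (R : realType) (al be ga de : R)
  (hal : -1 < al) (hbe : -1 < be) (hga : -1 < ga) (hde : -1 < de)
  (N : nat) (hN : (1 <= N)%N) (l r : 'I_N -> R)
  (hs : forall i, [/\ -1 <= l i, l i < r i & r i <= 1])
  (hadm : admissible (jweight ga de) l r) :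
  exists2 J : 'Hom(Pi R N, 'cV[R]_(1 + N)),
    J =1 Jmap al be ga de l r &
  exists Phi : N.-tuple (Pi R N),
    [/\ basis_of (jacobi_span al be N) Phi,
        basis_of {:Pi R N} (cons1 Phi),
        mx_of_lin (cons1 Phi) (canon_basis R (1 + N)) J =
          block_mx (moment al be (fun=> 1))%:M 0 0 (Dblock ga de l r Phi) &
        (Dblock ga de l r Phi)^T *m Dblock ga de l r Phi = 1%:M].
Proof.
have [J JE] := linear_linfun _ _ _ _ (Jmap_linear _ _ _ _ _ _ _ _ hal hbe hga hde hs).
exists J => //.
pose V := jacobi_span al be N.
(* [T] is the lower part of [J]: the vector of derivative moments. *)
have [T TJ] : exists h : 'Hom(Pi R N, 'cV[R]_N), h =1 (fun p => dsubmx (J p)).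
  by apply: linear_linfun => c p q; rewrite !linearP.
have TE p i : T p i 0 = segdiff (jweight ga de) (l i) (r i) (horner p).
  by rewrite TJ JE /Jmap col_mxKd mxE.
have h0 := moment1_gt0 al be hal hbe.
have m0 p : p \in V -> moment al be (horner p) = 0.
  exact: moment_jacobi_span.
have dimV : \dim V = N.
  by have /eqP := jacobi_free R al be N hal hbe; rewrite size_tuple.
have one1 : npolyp N.+1 1 = 1 :> {poly R}.
  by rewrite npolypK// size_poly1.
have horner1 : horner (1 : {poly R}) = fun=> 1.
  by apply/funext => x; rewrite -polyC1 hornerC.
have oneV : npolyp N.+1 1 \notin V.
  apply/negP => /m0; rewrite one1 horner1 => h; by rewrite h ltxx in h0.
(* An element of [V] killed by [T] has zero derivative, so it is a constant [c]; its moment, [c]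
   times that of 1, vanishes, hence [c = 0]. *)
have kerT : (V :&: lker T)%VS = 0%VS.
  apply/eqP; rewrite -subv0; apply/subvP => p; rewrite memv_cap memv_ker memv0.
  move=> /andP[pV /eqP Tp].
  have dp : (p : {poly R})^`() = 0.
    apply: (admissible_deriv_inj _ _ _ _ _ _ hN _ hadm); first exact: size_npoly.
    by move=> i; rewrite -TE Tp mxE.
  (* The summand 0 gives the shape to which [segint_linear] applies. *)
  have pC : p = (p : {poly R})`_0 *: 1 + 0 :> {poly R}.
    rewrite addr0 alg_polyC; apply/polyP => -[|i]; rewrite coefC//=.
    have := congr1 (fun q : {poly R} => q`_i) dp; rewrite /= coef_deriv coef0 => /eqP.
    by rewrite mulrn_eq0/= => /eqP.
  have := m0 p pV; rewrite pC /moment -/(segint _ _ _ _) segint_linear// segint0 addr0.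
  rewrite -[segint _ _ _ _]/(moment _ _ _) horner1 => /eqP.
  rewrite mulf_eq0 (gt_eqF h0) orbF => /eqP p0.
  by apply/eqP/val_inj; rewrite /= pC p0 scale0r addr0.
(* [T] is injective on [V], whose dimension equals that of the target. *)
have imT : (T @: V = fullv)%VS.
  by apply/eqP; rewrite eqEdim subvf/= limg_dim_eq// dimV dimvf dim_matrix mulr1 leqnn.
have Phi_ex (k : 'I_N) : exists p, p \in V /\ T p = delta_mx k 0.
  have : delta_mx k 0 \in (T @: V)%VS by rewrite imT memvf.
  by move/memv_imgP => [p pV pE]; exists p.
have [phi phiP] := choice Phi_ex.
pose Phi : N.-tuple (Pi R N) := [tuple phi k | k < N].
have PhiE (k : 'I_N) : Phi`_k = phi k by rewrite -tnth_nth tnth_mktuple.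
have D1 : Dblock ga de l r Phi = 1%:M.
  by apply/matrixP => i k; rewrite !mxE tnth_mktuple -TE (phiP k).2 mxE eqxx andbT.
have PhiV : (<<Phi>> <= V)%VS.
  apply/span_subvP => p /mapP[k _ ->]; exact: (phiP k).1.
(* [T] sends a vanishing combination of [Phi] to the same combination of standard columns, where the
   coefficients can be read off. *)
have freePhi : free Phi.
  apply/freeP => c c0 i; move/(congr1 T) : c0; rewrite linear_sum linear0.
  move/colP => /(_ i); rewrite summxE mxE (bigD1 i)//= big1 => [|k ki].
    by rewrite addr0 PhiE linearZ/= (phiP i).2 !mxE !eqxx mulr1.
  by rewrite PhiE linearZ/= (phiP k).2 !mxE eq_sym (negbTE ki) mulr0.
have basPhi : basis_of V Phi by rewrite basisEfree freePhi PhiV dimV size_tuple/=.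
exists Phi; split => //.
- rewrite basisEfree subvf dim_polyn size_tuple leqnn !andbT.
  by rewrite -[tval _]/(_ :: tval Phi) free_cons freePhi andbT (span_basis basPhi).
- have tn0 : tnth (cons1 Phi) (lshift N ord0) = npolyp N.+1 1 by rewrite (tnth_nth 0).
  have tnS k : tnth (cons1 Phi) (rshift 1 k) = phi k.
    by rewrite (tnth_nth 0)/= PhiE.
  apply/matrixP => i j; rewrite [LHS]mxE canon_basis_coord JE /Jmap.
  (* Of the four blocks the lower right one closes by computation. The others are the moment of 1,
     the zero moments of [V], and the zero derivative of 1. *)
  have [{}i ->|{}i ->] := split_ordP i; have [{}j ->|{}j ->] := split_ordP j;
    rewrite ?(block_mxEul, block_mxEur, block_mxEdl, block_mxEdr)
      ?(col_mxEu, col_mxEd) ?ord1 ?tn0 ?tnS !mxE ?tnth_mktuple//.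
  + by rewrite one1 horner1.
  + by rewrite m0// (phiP j).1.
  + by rewrite one1 segdiff_horner -polyC1 derivC segint0.
- by rewrite D1 trmx1 mulmx1.
Qed.
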